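(* Let $n$ be a positive integer. If the log-Brunn-Minkowski inequality is correct in dimension $n$, that is, if $$V(\lambda\cdot K+_o(1-\lambda)\cdot L)\geq V(K)^{\lambda}V(L)^{1-\lambda}$$ for all $\lambda\in[0,1]$ and all symmetric convex bodies $K, L$ in $\mathbb{R}^n$, then the uniform probability measure of every symmetric convex body in $\mathbb{R}^n$ has the weak (B)-property.
   Context: A convex body in $\mathbb{R}^n$ is a compact convex set with non-empty interior; $K$ is symmetric if $K=-K$; $V$ denotes $n$-dimensional volume. The support function of $K$ is $h_K(x)=\max\{x\cdot y : y\in K\}$, and the 0-convex combination is $$\lambda\cdot K+_o(1-\lambda)\cdot L=\{x\in\mathbb{R}^n : x\cdot u\le h_K^{\lambda}(u)h_L^{1-\lambda}(u)\text{ for all }u\in S^{n-1}\}.$$ The uniform probability measure of a symmetric convex body $K$ is $\mu_K(A)=V(K\cap A)/V(K)$. A Borel measure $\mu$ on $\mathbb{R}^n$ has the weak (B)-property if for any symmetric convex body $K$ in $\mathbb{R}^n$ and any positive number $t$, the function $s\mapsto\mu(t^{s}K)$, $s\in\mathbb{R}$, is log-concave. *)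

(* Defs.v *)
From HB Require Import structures.
From mathcomp Require Import all_boot all_order all_algebra.
From mathcomp Require Import all_classical all_reals all_analysis.
From mathcomp Require Import measurable_realfun.

Set Implicit Arguments.
Unset Strict Implicit.
Unset Printing Implicit Defensive.

Import Order.TTheory GRing.Theory Num.Theory.
Import numFieldNormedType.Exports.

Local Open Scope classical_set_scope.
Local Open Scope ring_scope.

(* R^n is 'rV[R]_n, equipped with its Borel sigma-algebra. *)
Section borel_rV.
Context {R : realType} {n : nat}.

HB.instance Definition _ :=
  Measurable.copy 'rV[R]_n (g_sigma_algebraType (@open 'rV[R]_n)).

Lemma open_measurable_rV (A : set 'rV[R]_n) : open A -> measurable A.
Proof. by move=> oA; exact: sub_sigma_algebra. Qed.

Lemma closed_measurable_rV (A : set 'rV[R]_n) : closed A -> measurable A.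
Proof.
move=> cA; rewrite -(setCK A); apply: measurableC; apply: open_measurable_rV.
exact: closed_openC.
Qed.

Lemma measurable_coord (i : 'I_n) :
  measurable_fun [set: 'rV[R]_n] (fun v : 'rV[R]_n => v ord0 i).
Proof.
apply: (measurability _ (measurable_realfun.RGenInftyO.measurableE R)) => _ [_ [a ->] <-].
rewrite setTI; apply: open_measurable_rV.
apply: open_comp; last exact: interval_open.
by move=> x _; exact: coord_continuous.
Qed.

End borel_rV.

Lemma measurable_fun_rV d (T : measurableType d) (R : realType) n
    (f : T -> 'rV[R]_n) :
  (forall i, measurable_fun [set: T] (fun x => f x ord0 i)) ->
  measurable_fun [set: T] f.
Proof.
move=> mf; apply: (@measurability _ _ _ _ _ _ (@open 'rV[R]_n) erefl) => _ [U oU <-]; rewrite setTI.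
pose cube (c : 'rV[rat]_n * nat) : set 'rV[R]_n :=
  [set v | forall i, ball (ratr (c.1 ord0 i) : R) c.2.+1%:R^-1 (v ord0 i)].
pose W c := [set x | cube c `<=` U /\ cube c (f x)].
have -> : f @^-1` U = \bigcup_c W c.
  apply/seteqP; split => [x /= Ux|x [c _ [+ cx]]]; last exact.
  have /nbhs_ballP[e /= e0 eU] : nbhs (f x) U by exact: open_nbhs_nbhs.
  have [k ke] : exists k, k.+1%:R^-1 < e / 2 :> R.
    by have /ltr_add_invr[k] := @divr_gt0 _ e 2 e0 ltac:(by []); rewrite add0r; exists k.
  have k0 : 0 < k.+1%:R^-1 :> R by rewrite invr_gt0.
  have /choice[q qx] (i : 'I_n) :
      exists q : rat, ball (ratr q : R) k.+1%:R^-1 (f x ord0 i).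
    have /rat_in_itvoo[q] : f x ord0 i - k.+1%:R^-1 < f x ord0 i + k.+1%:R^-1.
      by rewrite ltrBlDr -addrA ltrDl addr_gt0.
    rewrite in_itv/= => /andP[q1 q2]; exists q.
    by rewrite /ball/= ltr_distl q1.
  have cx : cube (\row_i q i, k) (f x) by move=> i; rewrite /= mxE; exact: qx.
  exists (\row_i q i, k) => //; split => // v cv; apply: eU.
  split => // i j; rewrite (ord1 i).
  apply: (@le_ball _ _ _ (k.+1%:R^-1 + k.+1%:R^-1)).
    by rewrite [leRHS]splitr lerD// ltW.
  apply: ball_triangle (cv j); apply: ball_sym; exact: cx.
apply: countable_bigcupT_measurable => [|c]; first exact: countableP.
have [cU|ncU] := pselect (cube c `<=` U); last first.
  rewrite (_ : W c = set0)//; apply/seteqP; split => // x [].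
  by move=> /ncU.
rewrite (_ : W c = \bigcap_(i in [set: 'I_n])
    (fun x => f x ord0 i) @^-1` ball (ratr (c.1 ord0 i) : R) c.2.+1%:R^-1).
  apply: fin_bigcap_measurable => // i _.
  rewrite -[X in measurable X]setTI; apply: mf => //.
  by apply: open_measurable; apply: ball_open; rewrite invr_gt0.
apply/seteqP; split => x /=.
  by move=> [_ cx] i _; exact: cx.
by move=> cx; split => // i; exact: cx.
Qed.

Section cons_rV.
Context {R : realType} {n : nat}.

Definition cons_rV (p : R * 'rV[R]_n) : 'rV[R]_n.+1 := row_mx p.1%:M p.2.

Definition uncons_rV (v : 'rV[R]_n.+1) : R * 'rV[R]_n :=
  (v ord0 ord0, \row_j v ord0 (lift ord0 j)).

Lemma cons_rV0 p : cons_rV p ord0 ord0 = p.1.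
Proof.
rewrite mxE; case: splitP => [j _|j //].
by rewrite !ord1 mxE eqxx mulr1n.
Qed.

Lemma cons_rVS p j : cons_rV p ord0 (lift ord0 j) = p.2 ord0 j.
Proof.
rewrite mxE; case: splitP => [k|k [jk]]; first by rewrite ord1.
by congr (p.2 _ _); exact: val_inj.
Qed.

Lemma cons_rVK : cancel cons_rV uncons_rV.
Proof.
case=> x v; rewrite /uncons_rV cons_rV0; congr pair.
by apply/rowP => j; rewrite mxE cons_rVS.
Qed.

Lemma measurable_cons_rV : measurable_fun [set: R * 'rV[R]_n] cons_rV.
Proof.
apply: measurable_fun_rV => i; case: (unliftP ord0 i) => [j ->|->].
- under eq_fun do rewrite cons_rVS.
  exact: (measurableT_comp (measurable_coord j) measurable_snd).
- by under eq_fun do rewrite cons_rV0; exact: measurable_fst.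
Qed.

Lemma measurable_uncons_rV : measurable_fun [set: 'rV[R]_n.+1] uncons_rV.
Proof.
apply: measurable_fun_pair; first exact: measurable_coord.
apply: measurable_fun_rV => i; under eq_fun do rewrite mxE.
exact: measurable_coord.
Qed.

Variable mu : {sigma_finite_measure set 'rV[R]_n -> \bar R}.

Definition lebesgue_cons : set 'rV[R]_n.+1 -> \bar R :=
  pushforward (@lebesgue_measure R \x mu)%E cons_rV.

Let lebesgue_cons0 : lebesgue_cons set0 = 0%E.
Proof. by rewrite /lebesgue_cons /pushforward preimage_set0 measure0. Qed.

Let lebesgue_cons_ge0 A : (0 <= lebesgue_cons A)%E.
Proof. by rewrite /lebesgue_cons /pushforward measure_ge0. Qed.

Let mpreimage A : measurable A -> measurable (cons_rV @^-1` A).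
Proof. by move=> mA; rewrite -[X in measurable X]setTI; exact: measurable_cons_rV. Qed.

Let lebesgue_cons_sigma_additive : semi_sigma_additive lebesgue_cons.
Proof.
move=> F mF tF mUF; rewrite /lebesgue_cons /pushforward preimage_bigcup.
apply: measure_semi_sigma_additive.
- by move=> k; exact: mpreimage.
- apply/trivIsetP => /= i j _ _ ij; rewrite -preimage_setI.
  by move/trivIsetP : tF => /(_ _ _ _ _ ij) ->//; rewrite preimage_set0.
- by rewrite -preimage_bigcup; exact: mpreimage.
Qed.

HB.instance Definition _ := isMeasure.Build _ _ _ lebesgue_cons
  lebesgue_cons0 lebesgue_cons_ge0 lebesgue_cons_sigma_additive.

Let lebesgue_cons_sigma_finite : sigma_finite setT lebesgue_cons.
Proof.
have /sigma_finiteP[F [FT ndF mF]] := sigma_finiteT (@lebesgue_measure R).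
have /sigma_finiteP[G [GT ndG mG]] := sigma_finiteT mu.
exists (fun k => uncons_rV @^-1` (F k `*` G k)).
  apply/esym/seteqP; split => // v _ /=.
  have [i _ Fi] : (\bigcup_i F i) (uncons_rV v).1 by rewrite -FT.
  have [j _ Gj] : (\bigcup_i G i) (uncons_rV v).2 by rewrite -GT.
  exists (maxn i j) => //; split.
  - by move: Fi; exact/subsetPset/ndF/leq_maxl.
  - by move: Gj; exact/subsetPset/ndG/leq_maxr.
move=> k; have [mFk Fk] := mF k; have [mGk Gk] := mG k; split.
  rewrite -[X in measurable X]setTI; apply: measurable_uncons_rV => //.
  exact: measurableX.
rewrite /lebesgue_cons /pushforward -comp_preimage.
rewrite (_ : uncons_rV \o cons_rV = id); last first.
  by apply/funext => p /=; rewrite cons_rVK.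
by rewrite preimage_id product_measure1E// lte_mul_pinfty// ge0_fin_numE.
Qed.

HB.instance Definition _ := Measure_isSigmaFinite.Build _ _ _ lebesgue_cons
  lebesgue_cons_sigma_finite.

End cons_rV.

(* n-dimensional Lebesgue measure, as the n-fold product of the one on R. *)
Fixpoint vol (R : realType) (n : nat) : {sigma_finite_measure set 'rV[R]_n -> \bar R} :=
  match n with
  | 0 => \d_ (0 : 'rV[R]_0)
  | m.+1 => lebesgue_cons (vol R m)
  end.

Lemma vol_box (R : realType) n (A : 'I_n -> set R) :
  (forall i, measurable (A i)) ->
  vol R n [set v | forall i, A i (v ord0 i)] =
  (\prod_(i < n) lebesgue_measure (A i))%E.
Proof.
elim: n A => [|n IH] A mA /=.
  by rewrite big_ord0 diracE mem_set// => i; have := ltn_ord i.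
rewrite big_ord_recl -IH//= /lebesgue_cons /pushforward.
set B := [set v : 'rV[R]_n | forall i, A (lift ord0 i) (v ord0 i)].
have mB : measurable B.
  rewrite (_ : B = \bigcap_(i in [set: 'I_n])
      (fun v : 'rV[R]_n => v ord0 i) @^-1` A (lift ord0 i)).
    apply: fin_bigcap_measurable => // i _.
    by rewrite -[X in measurable X]setTI; exact: measurable_coord.
  by apply/seteqP; split => v /= Bv i; [move=> _|]; exact: Bv.
rewrite -[RHS](product_measure1E (@lebesgue_measure R) (vol R n) (mA ord0) mB).
congr (_ _).
apply/seteqP; split => [p /= Ap|p [A0 Bp] /= i].
  split; first by rewrite -cons_rV0.
  by move=> i; rewrite -cons_rVS.
by case: (unliftP ord0 i) => [j ->|->]; rewrite (cons_rVS, cons_rV0).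
Qed.

Section convex_bodies.
Context {R : realType} {n : nat}.
Implicit Types (K L A : set 'rV[R]_n) (x y u : 'rV[R]_n).

Definition dot x y : R := \sum_(i < n) x ord0 i * y ord0 i.

Definition dilate (a : R) A : set 'rV[R]_n := [set a *: x | x in A].

Definition convex_body K : Prop :=
  [/\ compact K, convex_set K & interior K !=set0].

Definition symmetric_set K : Prop := K = [set - x | x in K].

Definition symmetric_convex_body K : Prop := convex_body K /\ symmetric_set K.

(* The supremum is a maximum when K is compact and non-empty. *)
Definition support_function K x : R := sup [set dot x y | y in K].

(* The norm of 'rV[R]_n being the sup norm, the Euclidean unit sphere is
   written with [dot]. *)
Definition log_combination (l : R) K L : set 'rV[R]_n :=
  [set x | forall u, dot u u = 1 ->
     dot x u <= support_function K u `^ l * support_function L u `^ (1 - l)].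

Lemma compact_measurable_rV K : compact K -> measurable K.
Proof.
move=> cK; apply: closed_measurable_rV; exact: compact_closed.
Qed.

Lemma vol_compact_fin K : compact K -> (vol R n K < +oo)%E.
Proof.
move=> cK; have [M [_ KM]] := compact_bounded cK.
pose B := [set v : 'rV[R]_n | forall i, `[- (`|M| + 1), `|M| + 1]%classic (v ord0 i)].
have KB : K `<=` B.
  move=> v Kv i /=; rewrite in_itv/= -ler_norml.
  have M1 : M < `|M| + 1 by rewrite (le_lt_trans (ler_norm M))// ltrDl.
  have /(_ v Kv) vM := KM _ M1.
  apply: le_trans vM; rewrite [leRHS]mx_normrE.
  exact: (le_bigmax _ (fun ij => `|v ij.1 ij.2|) (ord0, i)).
have mB : measurable B.
  apply: compact_measurable_rV.
  apply: (@rV_compact R n (fun=> `[- (`|M| + 1), `|M| + 1]%classic)) => i.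
  exact: segment_compact.
apply: (@le_lt_trans _ _ (vol R n B)).
  by apply: le_measure => //; rewrite inE//; exact: compact_measurable_rV.
rewrite [X in (X < _)%E](@vol_box R n (fun=> `[- (`|M| + 1), `|M| + 1]%classic)) => [|i]; last first.
  exact: measurable_itv.
rewrite ltey_eq; apply/orP; left.
apply: (big_ind (fun e : \bar R => e \is a fin_num)) => [//|a b|i _].
- exact: fin_numM.
- by rewrite lebesgue_measure_itv/=; case: ifP.
Qed.

Lemma vol_interior_gt0 K : compact K -> interior K !=set0 -> (0 < vol R n K)%E.
Proof.
move=> cK [x /nbhs_ballP[e /= e0 eK]].
pose B := [set v : 'rV[R]_n | forall i, ball (x ord0 i) e (v ord0 i)].
have BK : B `<=` K by move=> v Bv; apply: eK; split => // i j; rewrite ord1.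
have mball i : measurable (ball (x ord0 i) e : set R).
  by apply: open_measurable; exact: ball_open.
have mB : measurable B.
  rewrite (_ : B = \bigcap_(i in [set: 'I_n])
      (fun v : 'rV[R]_n => v ord0 i) @^-1` ball (x ord0 i) e).
    apply: fin_bigcap_measurable => // i _.
    by rewrite -[X in measurable X]setTI; exact: measurable_coord.
  by apply/seteqP; split => v /= Bv i; [move=> _|]; exact: Bv.
apply: (@lt_le_trans _ _ (vol R n B)); last first.
  by apply: le_measure => //; rewrite inE//; exact: compact_measurable_rV.
rewrite [X in (_ < X)%E](vol_box mball); apply: (big_ind (fun e : \bar R => 0 < e)%E) => [//|a b|i _].
- exact: mule_gt0.
- by rewrite lebesgue_measure_ball ?ltW// lte_fin mulrn_wgt0.
Qed.

Section uniform.
Variable K : set 'rV[R]_n.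

Definition uniform_measure (hK : symmetric_convex_body K) A : \bar R :=
  (vol R n (K `&` A) / vol R n K)%E.

Variable hK : symmetric_convex_body K.

Let mK : measurable K.
Proof. by case: hK => -[cK _ _] _; exact: compact_measurable_rV. Qed.

Let volK_gt0 : (0 < vol R n K)%E.
Proof. by case: hK => -[cK _ iK] _; exact: vol_interior_gt0. Qed.

Let volK_fin : vol R n K \is a fin_num.
Proof. by rewrite ge0_fin_numE// vol_compact_fin//; case: hK => -[]. Qed.

Let c : {nonneg R} := NngNum (ltac:(by rewrite invr_ge0 fine_ge0) :
  0 <= (fine (vol R n K))^-1).

Let uniformE A : uniform_measure hK A = mscale c (mrestr (vol R n) mK) A.
Proof.
rewrite /uniform_measure /mscale/= /mrestr setIC muleC; congr (_ * _)%E.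
by rewrite -[in LHS](fineK volK_fin) inver gt_eqF// fine_gt0// volK_gt0 ltey_eq volK_fin.
Qed.

Let uniform0 : uniform_measure hK set0 = 0%E.
Proof. by rewrite uniformE measure0. Qed.

Let uniform_ge0 A : (0 <= uniform_measure hK A)%E.
Proof. by rewrite uniformE measure_ge0. Qed.

Let uniform_sigma_additive : semi_sigma_additive (uniform_measure hK).
Proof.
rewrite (_ : uniform_measure hK = mscale c (mrestr (vol R n) mK)).
  exact: measure_semi_sigma_additive.
by apply/funext => A; rewrite uniformE.
Qed.

HB.instance Definition _ := isMeasure.Build _ _ _ (uniform_measure hK)
  uniform0 uniform_ge0 uniform_sigma_additive.

Let uniformT : uniform_measure hK [set: 'rV[R]_n] = 1%E.
Proof. by rewrite /uniform_measure setIT divee// gt_eqF. Qed.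

HB.instance Definition _ := Measure_isProbability.Build _ _ _
  (uniform_measure hK) uniformT.

End uniform.

(* Meant for f with values in [0, +oo] (a Borel measure may be infinite), with
   0 * +oo = 0 and x `^ 0 = 1. *)
Definition log_concave (f : R -> \bar R) : Prop :=
  forall (s t l : R), 0 <= l <= 1 ->
    (f s `^ l * f t `^ (1 - l) <= f (l * s + (1 - l) * t)%R)%E.

Definition weak_B_property (mu : {measure set 'rV[R]_n -> \bar R}) : Prop :=
  forall K, symmetric_convex_body K -> forall t : R, 0 < t ->
    log_concave (fun s => mu (dilate (t `^ s) K)).

End convex_bodies.

(* Main.v *)
Require Import Defs.
From mathcomp Require Import all_boot all_order all_algebra.
From mathcomp Require Import all_classical all_reals all_analysis.
From mathcomp Require Import ring lra.

(** Write a = t^s1, b = t^s2 and c = a^l b^(1-l) = t^(l s1 + (1-l) s2).  Up to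
    the normalising constant V(K), log-concavity of s |-> mu_K(t^s L) says that
      V(K `&` a L)^l V(K `&` b L)^(1-l) <= V(K `&` c L).
    The sets K `&` a L and K `&` b L are symmetric convex bodies, so by the
    log-Brunn-Minkowski inequality the left-hand side is at most the volume of
    their 0-convex combination; it remains to see that this combination lies
    in K `&` c L, which is [log_combination_dilate_sub].

    The support function of K `&` a L is bounded both by h_K and by a h_L.
    Taking weighted geometric means, the first bound gives
    h_K^l h_K^(1-l) = h_K, and the second gives
    (a h_L)^l (b h_L)^(1-l) = c h_L.  So every x in the combination satisfies
    x . u <= h_K(u) and x . u <= c h_L(u) for each unit vector u.  A compact
    convex set is the intersection of its supporting half-spaces
    ([mem_support_function]), hence x is in K and in c L. *)

Set Implicit Arguments.
Unset Strict Implicit.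
Unset Printing Implicit Defensive.

Import Order.TTheory GRing.Theory Num.Theory.
Import numFieldNormedType.Exports.

Local Open Scope classical_set_scope.
Local Open Scope ring_scope.

(** * The Euclidean inner product *)

Section dot_product.
Context {R : realType} {n : nat}.
Implicit Types (x y z : 'rV[R]_n).

Lemma dotC x y : dot x y = dot y x.
Proof. by apply: eq_bigr => i _; rewrite mulrC. Qed.

Lemma dotDl x y z : dot (x + y) z = dot x z + dot y z.
Proof. by rewrite -big_split; apply: eq_bigr => i _; rewrite mxE mulrDl. Qed.

Lemma dotZl (a : R) x z : dot (a *: x) z = a * dot x z.
Proof. by rewrite big_distrr; apply: eq_bigr => i _; rewrite mxE -mulrA. Qed.

Lemma dotDr x y z : dot x (y + z) = dot x y + dot x z.
Proof. by rewrite !(dotC x) dotDl. Qed.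

Lemma dotZr (a : R) x z : dot x (a *: z) = a * dot x z.
Proof. by rewrite !(dotC x) dotZl. Qed.

Lemma dotBl x y z : dot (x - y) z = dot x z - dot y z.
Proof. by rewrite -scaleN1r dotDl dotZl mulN1r. Qed.

Lemma dotBr x y z : dot x (y - z) = dot x y - dot x z.
Proof. by rewrite !(dotC x) dotBl. Qed.

Lemma dot_ge0 x : 0 <= dot x x.
Proof. by apply: sumr_ge0 => i _; rewrite -expr2 sqr_ge0. Qed.

Lemma dot_eq0 x : dot x x = 0 -> x = 0.
Proof.
move=> /eqP; rewrite psumr_eq0 => [/allP x0|i _]; last by rewrite -expr2 sqr_ge0.
apply/rowP => i; have := x0 i (mem_index_enum i).
by rewrite mulf_eq0 orbb mxE => /eqP.
Qed.

Lemma continuous_dot (T : topologicalType) (f g : T -> 'rV[R]_n) :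
  continuous f -> continuous g -> continuous (fun p => dot (f p) (g p)).
Proof.
move=> cf cg; apply: continuous_big => [|i _ p].
  exact: add_continuous.
apply: cvgM.
- exact: (continuous_comp (cf p) (@coord_continuous _ _ _ _ _ _)).
- exact: (continuous_comp (cg p) (@coord_continuous _ _ _ _ _ _)).
Qed.

End dot_product.

(** * Symmetric convex bodies: dilation and intersection *)

Section convex_sets.
Context {R : realType} {n : nat}.
Implicit Types (K L : set 'rV[R]_n) (x y u : 'rV[R]_n).

(** Trades the bundled coefficient of the abstract convex-space operation for a
    real number with explicit bounds, on which arithmetic can be done. *)
Lemma convex_setP K : convex_set K <->
  forall x y (t : R), 0 <= t <= 1 -> K x -> K y -> K (t *: x + (1 - t) *: y).
Proof.
split=> cK x y t.
  move=> /andP[t0 t1] Kx Ky.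
  have := cK x y (Itv01 t0 t1); rewrite !inE; exact.
rewrite !inE => Kx Ky; apply: cK => //.
by rewrite ge0 le1.
Qed.

Lemma symmetric_setP K : symmetric_set K <-> forall x, K x -> K (- x).
Proof.
split=> [sK x Kx|sK]; first by rewrite sK; exists x.
apply/seteqP; split=> [x Kx|_ [x Kx <-]]; last exact: sK.
by exists (- x); [exact: sK|rewrite opprK].
Qed.

Lemma dilateP (a : R) K x : a != 0 -> dilate a K x <-> K (a^-1 *: x).
Proof.
move=> a0; split=> [[y Ky <-]|Kx]; first by rewrite scalerA mulVf// scale1r.
by exists (a^-1 *: x) => //; rewrite scalerA mulfV// scale1r.
Qed.

(** If x is interior to K then, for small e, both x + e and x - e are in K;
    by symmetry - (x - e) is in K too, and e is the midpoint of x + e and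
    - (x - e).  This is what keeps the interior of an intersection of two
    symmetric convex bodies non-empty. *)
Lemma nbhs0_symmetric_convex_body K : symmetric_convex_body K -> nbhs 0 K.
Proof.
move=> [[_ /convex_setP cK [x Kx]] /symmetric_setP sK].
have Kx' : \forall e \near (0 : 'rV[R]_n), K (x + e).
  by have /nbhs0P : nbhs x K by [].
have KNx : \forall e \near (0 : 'rV[R]_n), K (x - e).
  have := nbhs0N Kx'; apply: filterS => _ [e Ke <-]; by rewrite opprK.
apply: filterS2 Kx' KNx => e Ke /sK KNe.
have -> : e = 2^-1 *: (x + e) + (1 - 2^-1) *: - (x - e).
  by apply/rowP => i; rewrite !mxE; field.
by apply: cK => //; lra.
Qed.

Lemma symmetric_convex_body_0 K : symmetric_convex_body K -> K 0.
Proof. by move=> /nbhs0_symmetric_convex_body; exact: nbhs_singleton. Qed.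

Lemma symmetric_convex_body_dilate (a : R) K : 0 < a ->
  symmetric_convex_body K -> symmetric_convex_body (dilate a K).
Proof.
move=> a0 hK; have K0 := nbhs0_symmetric_convex_body hK.
move: hK => [[cK /convex_setP coK _] /symmetric_setP sK].
split; first split.
- apply: continuous_compact cK; apply: continuous_subspaceT.
  exact: scaler_continuous.
- apply/convex_setP => _ _ t t01 [x Kx <-] [y Ky <-].
  exists (t *: x + (1 - t) *: y); first exact: coK.
  by rewrite scalerDr !scalerA !(mulrC a).
- by exists 0; apply: nbhs0Z => //; rewrite gt_eqF.
- apply/symmetric_setP => _ [x Kx <-]; exists (- x); first exact: sK.
  by rewrite scalerN.
Qed.

Lemma symmetric_convex_bodyI K L :
  symmetric_convex_body K -> symmetric_convex_body L ->
  symmetric_convex_body (K `&` L).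
Proof.
move=> hK hL; have K0 := nbhs0_symmetric_convex_body hK.
have L0 := nbhs0_symmetric_convex_body hL.
move: hK hL => [[cK /convex_setP coK _] /symmetric_setP sK].
move=> [[cL /convex_setP coL _] /symmetric_setP sL].
split; first split.
- by apply: compact_closedI => //; exact: compact_closed.
- apply/convex_setP => x y t t01 [Kx Lx] [Ky Ly].
  by split; [exact: coK|exact: coL].
- by exists 0; apply: filterI.
- by apply/symmetric_setP => x [Kx Lx]; split; [exact: sK|exact: sL].
Qed.

End convex_sets.

(** * Support functions and 0-convex combinations *)

Section support_functions.
Context {R : realType} {n : nat}.
Implicit Types (K L : set 'rV[R]_n) (x y u : 'rV[R]_n).

Lemma le_support_function K u y :
  compact K -> K y -> dot u y <= support_function K u.
Proof.
move=> cK Ky; apply: sup_upper_bound; last exact: imageP.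
apply: compact_has_sup; first by exists (dot u y), y.
apply: continuous_compact cK; apply: continuous_subspaceT.
by apply: continuous_dot => p; [exact: cst_continuous|move=> A].
Qed.

Lemma support_function_le K u (c : R) :
  K !=set0 -> (forall y, K y -> dot u y <= c) -> support_function K u <= c.
Proof.
move=> [y Ky] Kc; apply: ge_sup; first by exists (dot u y), y.
by move=> _ [z Kz <-]; exact: Kc.
Qed.

(** Separation by nearest point: let p be a point of K at minimal Euclidean
    distance from x and put w = x - p.  Minimality along segments from p forces
    w . y <= w . p on K, so in the direction u = w / |w| one has
    h_K(u) <= u . p = u . x - |w|; the hypothesis on x then gives w = 0. *)
Lemma mem_support_function K x :
  compact K -> convex_set K -> K !=set0 ->
  (forall u, dot u u = 1 -> dot x u <= support_function K u) -> K x.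
Proof.
move=> cK /convex_setP coK K0 xK.
have [p] : exists2 p, p \in K &
    forall y, y \in K -> dot (x - p) (x - p) <= dot (x - y) (x - y).
  apply: (@EVT_min_rV R n (fun p => dot (x - p) (x - p))) => //.
  apply: continuous_subspaceT.
  have cB : continuous (fun p : 'rV[R]_n => x - p).
    by move=> p; apply: continuousB; [exact: cst_continuous|move=> A].
  exact: continuous_dot.
rewrite inE => Kp pmin; move: pmin; move wE : (x - p) => w pmin.
have wK y : K y -> dot w y <= dot w p.
  move=> Ky; rewrite -subr_le0 -dotBr leNgt; apply/negP => d0.
  set d := dot w (y - p) in d0; set q := dot (y - p) (y - p).
  have q0 : 0 <= q by exact: dot_ge0.
  (* Moving from p towards y by t changes |x - p|^2 by t (t q - 2 d); this t
     is at most 1 and makes t q < 2 d even when q = 0. *)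
  pose t := d / (d + q).
  have dq0 : 0 < d + q by lra.
  have t01 : 0 <= t <= 1.
    apply/andP; split; first by apply: divr_ge0; exact: ltW.
    by rewrite ler_pdivrMr// mul1r lerDl.
  have := pmin (t *: y + (1 - t) *: p).
  rewrite inE => /(_ (coK _ _ _ t01 Ky Kp)).
  have -> : x - (t *: y + (1 - t) *: p) = w - t *: (y - p).
    by rewrite -wE; apply/rowP => i; rewrite !mxE; ring.
  rewrite dotBl !dotBr !dotZl !dotZr (dotC (y - p) w) -/d -/q.
  have tdq : t * (d + q) = d by rewrite divfK// gt_eqF.
  have t0 : 0 < t by rewrite divr_gt0.
  have : t * (t * q) < t * (2 * d) by rewrite ltr_pM2l//; nra.
  lra.
have [w0|w0] := eqVneq (dot w w) 0.
  by move/dot_eq0/eqP: w0; rewrite -wE subr_eq0 => /eqP ->.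
have {}w0 : 0 < dot w w by rewrite lt_def w0 dot_ge0.
set r := Num.sqrt (dot w w).
have r0 : 0 < r by rewrite sqrtr_gt0.
have rr : r * r = dot w w by rewrite -expr2 sqr_sqrtr// ltW.
have uu : dot (r^-1 *: w) (r^-1 *: w) = 1.
  by rewrite dotZl dotZr -rr; field; rewrite gt_eqF.
have : dot x (r^-1 *: w) <= r^-1 * dot w p.
  apply: le_trans (xK _ uu) _; apply: support_function_le => // y Ky.
  by rewrite dotZl ler_pM2l ?invr_gt0// wK.
rewrite dotZr ler_pM2l ?invr_gt0// dotC -subr_le0 -dotBr wE => ww.
by move: w0; rewrite ltNge ww.
Qed.

(** An intersection of closed half-spaces, hence Borel: monotonicity of the
    volume applies to it. *)
Lemma closed_log_combination (l : R) K L : closed (log_combination l K L).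
Proof.
rewrite (_ : log_combination l K L = \bigcap_(u in [set u | dot u u = 1])
    (fun x => dot x u) @^-1` [set s | s <= support_function K u `^ l
                                * support_function L u `^ (1 - l)]); last first.
  by apply/seteqP; split=> x xKL u /= uu; exact: xKL.
apply: closed_bigI => u _; apply: preimage_closed; last exact: closed_le.
by move=> x _; apply: continuous_dot => p; [move=> A|exact: cst_continuous].
Qed.

(** The min of the two bounds h_K and a h_L on the support function of
    K `&` a L is used one bound at a time: h_K yields membership in K, a h_L
    membership in the dilate of L by the geometric mean of a and b. *)
Lemma log_combination_dilate_sub (l a b : R) K L :
  0 <= l <= 1 -> 0 < a -> 0 < b ->
  symmetric_convex_body K -> symmetric_convex_body L ->
  log_combination l (K `&` dilate a L) (K `&` dilate b L)
    `<=` K `&` dilate (a `^ l * b `^ (1 - l)) L.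
Proof.
move=> /andP[l0 l1] a0 b0 hK hL x xKL.
have ol0 : 0 <= 1 - l by rewrite subr_ge0.
have K0 := symmetric_convex_body_0 hK; have L0 := symmetric_convex_body_0 hL.
have [[cK coK _] _] := hK; have [[cL coL _] _] := hL.
have hI c : 0 < c -> symmetric_convex_body (K `&` dilate c L).
  by move=> c0; apply: symmetric_convex_bodyI => //;
    exact: symmetric_convex_body_dilate.
have I0 c : 0 < c -> (K `&` dilate c L) 0.
  by move=> /hI; exact: symmetric_convex_body_0.
have h_ge0 M u : compact M -> M 0 -> 0 <= support_function M u.
  move=> cM M0; have := le_support_function u cM M0.
  by rewrite -[X in dot u X](scale0r 0) dotZr mul0r.
have hI_ge0 c u : 0 < c -> 0 <= support_function (K `&` dilate c L) u.
  by move=> c0; have [[cI _ _] _] := hI c c0; apply: h_ge0 => //; exact: I0.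
have hI_leK c u : 0 < c ->
    support_function (K `&` dilate c L) u <= support_function K u.
  move=> c0; apply: support_function_le; first by exists 0; exact: I0.
  by move=> y [Ky _]; exact: le_support_function.
have hI_leL c u : 0 < c ->
    support_function (K `&` dilate c L) u <= c * support_function L u.
  move=> c0; apply: support_function_le; first by exists 0; exact: I0.
  move=> _ [_ [y Ly <-]]; rewrite dotZr ler_pM2l//.
  exact: le_support_function.
have powh (M N A B : R) : 0 <= M <= A -> 0 <= N <= B ->
    M `^ l * N `^ (1 - l) <= A `^ l * B `^ (1 - l).
  move=> /andP[M0 MA] /andP[N0 NB]; apply: ler_pM; rewrite ?powR_ge0//.
  - by apply: ge0_ler_powR; rewrite // nnegrE// (le_trans M0).
  - by apply: ge0_ler_powR; rewrite // nnegrE// (le_trans N0).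
have powD (A : R) : 0 <= A -> A `^ l * A `^ (1 - l) = A.
  move=> A0; rewrite -powRD; last by rewrite addrC subrK oner_eq0.
  by rewrite addrC subrK powRr1.
set c := a `^ l * b `^ (1 - l).
have c0 : 0 < c by rewrite mulr_gt0// powR_gt0.
split.
  apply: mem_support_function => //; first by exists 0.
  move=> u uu; rewrite -[leRHS]powD ?h_ge0//.
  by apply: le_trans (xKL u uu) _; apply: powh; rewrite hI_ge0// hI_leK.
apply/dilateP; first by rewrite gt_eqF.
apply: mem_support_function => //; first by exists 0.
move=> u uu; rewrite dotZl mulrC ler_pdivrMr// mulrC.
apply: le_trans (xKL u uu) _.
rewrite -(powD (support_function L u)) ?h_ge0// mulrACA -!powRM ?h_ge0 ?(ltW a0) ?(ltW b0)//.
by apply: powh; rewrite hI_ge0// hI_leL.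
Qed.

End support_functions.

(** * From volumes to the uniform measure *)

(** The weights l and 1 - l add up to 1, so a weighted geometric mean is
    homogeneous of degree 1. *)
Lemma poweR_div_geometric_mean (R : realType) (l : R) (a b c : \bar R) :
  0 <= l <= 1 ->
  (0 <= a -> 0 <= b -> 0 < c -> a < +oo -> b < +oo -> c < +oo ->
  (a / c) `^ l * (b / c) `^ (1 - l) = (a `^ l * b `^ (1 - l)) / c)%E.
Proof.
move=> /andP[l0 l1].
case: a => [a| |]//; case: b => [b| |]//; case: c => [c| |]//.
rewrite !lee_fin lte_fin => a0 b0 c0 _ _ _.
rewrite !inver gt_eqF// -(EFinM a) -(EFinM b) !poweR_EFin -!EFinM; congr EFin.
have ci0 : 0 <= c^-1 by rewrite invr_ge0 ltW.
rewrite !powRM// mulrACA -powRD; last by rewrite addrC subrK oner_eq0.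
by rewrite [l + _]addrC subrK powRr1.
Qed.

Theorem theorem1p6 (R : realType) (n : nat) (n_gt0 : (0 < n)%N) :
  (forall l : R, 0 <= l <= 1 ->
     forall K L : set 'rV[R]_n,
       symmetric_convex_body K -> symmetric_convex_body L ->
       (vol R n K `^ l * vol R n L `^ (1 - l)
          <= vol R n (log_combination l K L))%E) ->
  forall (K : set 'rV[R]_n) (hK : symmetric_convex_body K),
    weak_B_property (uniform_measure hK).
Proof.
move=> logBM K hK L hL t t0 s1 s2 l l01.
have hI s : symmetric_convex_body (K `&` dilate (t `^ s) L).
  apply: symmetric_convex_bodyI => //; apply: symmetric_convex_body_dilate => //.
  exact: powR_gt0.
have [[cK _ iK] _] := hK; have vK0 := vol_interior_gt0 cK iK.
have cI s : compact (K `&` dilate (t `^ s) L) by have [[]] := hI s.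
rewrite /= /uniform_measure poweR_div_geometric_mean ?vol_compact_fin//.
apply: lee_wpmul2r; first by rewrite inve_ge0 ltW.
apply: le_trans (logBM l l01 _ _ (hI s1) (hI s2)) _.
apply: le_measure; rewrite ?inE.
- by apply: closed_measurable_rV; exact: closed_log_combination.
- exact: compact_measurable_rV.
have -> : t `^ (l * s1 + (1 - l) * s2) = (t `^ s1) `^ l * (t `^ s2) `^ (1 - l).
  by rewrite -!powRrM powRD ?(gt_eqF t0) ?implybT// ![_ * l]mulrC [s2 * _]mulrC.
by apply: log_combination_dilate_sub => //; exact: powR_gt0.
Qed.
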